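(* Let $G$ and $H$ be finite groups, let $\chi_0,\dots,\chi_r$ be the distinct irreducible complex characters of $G$ and let $\psi_0,\dots,\psi_s$ be the distinct irreducible complex characters of $H$. Let $\rho$ be a finite-dimensional complex representation of $G$ and $\sigma$ a finite-dimensional complex representation of $H$. Let $a_{ij}$ be the number of arrows from $\chi_i$ to $\chi_j$ in the McKay quiver $Q_\rho(G)$ and let $b_{kl}$ be the number of arrows from $\psi_k$ to $\psi_l$ in the McKay quiver $Q_\sigma(H)$. Then in the McKay quiver $Q_{\rho\otimes\sigma}(G\times H)$ of $G\times H$ relative to $\rho\otimes\sigma$, the number of arrows from $\chi_i\times\psi_k$ to $\chi_j\times\psi_l$ is $a_{ij}b_{kl}$, for all $0\le i,j\le r$ and $0\le k,l\le s$.
   Context: For a finite group $G$ with complex irreducible representations $\rho_0,\dots,\rho_r$ (up to isomorphism) and a (possibly reducible) complex representation $\rho$ of $G$, write $\rho\otimes\rho_i\cong\bigoplus_j a_{ij}\rho_j$. The McKay quiver $Q_\rho(G)$ has one vertex for each irreducible representation $\rho_i$ (equivalently, for its character $\chi_i$) and $a_{ij}$ arrows from the $i$-th vertex to the $j$-th vertex. Given representations $V$ of $G$ and $W$ of $H$, $V\otimes W$ is a representation of $G\times H$ by $(g,h)(v\otimes w)=gv\otimes hw$. For characters $\chi$ of $G$ and $\psi$ of $H$, $(\chi\times\psi)(g,h)=\chi(g)\psi(h)$; the irreducible characters of $G\times H$ are exactly the $(r+1)(s+1)$ distinct characters $\chi_i\times\psi_k$, which label the vertices of $Q_{\rho\otimes\sigma}(G\times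 H)$. *)

(* Defs.v *)
From HB Require Import structures.
From mathcomp Require Import all_boot all_order all_algebra all_fingroup.
From mathcomp Require Import all_solvable all_field all_character.
From mathcomp Require Import boolp classical_sets reals.
From mathcomp Require Import complex.

Set Implicit Arguments.
Unset Strict Implicit.
Unset Printing Implicit Defensive.

Import GRing.Theory Num.Theory.
Local Open Scope ring_scope.

Section Repr.

Variables (R : realType) (gT : finGroupType) (G : {group gT}).
Local Notation C := R[i].

(* As for [cfRepr], characters vanish outside G: a function on G is then
   determined by its extension to gT, and equality of characters is (=).
   ([cfRepr] itself is only available over algC.) *)
Definition repr_char n (rG : mx_representation C G n) : {ffun gT -> C} :=
  [ffun x => \tr (rG x) *+ (x \in G)].

Definition is_irr_char (f : {ffun gT -> C}) : Prop :=
  exists n (rG : mx_representation C G n),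
    mx_irreducible rG /\ repr_char rG = f.

Definition irr_char_enum r (chi : 'I_r.+1 -> {ffun gT -> C}) : Prop :=
  injective chi /\ forall f, is_irr_char f <-> exists i, chi i = f.

(* Indexes the irreducible representations [irr_repr i] of G over C, one for
   each isomorphism class. *)
Definition irrs : irrType C G := DecSocleType (regular_repr C G).

Definition irr_dsum (mult : {ffun irrs -> nat}) : representation C G :=
  \big[@dadd_grepr _ _ _/grepr0]_(i : irrs)
    muln_grepr (Representation (irr_repr i)) (mult i).

(* The multiplicities of the irreducible representations in rG; they exist by
   [irr_multP] below and are unique, so the default value is never used. *)
Definition irr_mult n (rG : mx_representation C G n) : {ffun irrs -> nat} :=
  xget [ffun => 0%N] [set mult | mx_rsim rG (irr_dsum mult)].

Section McKay.

Variables (n : nat) (rho : mx_representation C G n).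

Definition McKay_mx (i j : irrs) : nat :=
  irr_mult (prod_repr rho (irr_repr i)) j.

(* The number of arrows from the vertex with character f to the vertex with
   character f'. Distinct vertices have distinct characters, so when f and f'
   are irreducible characters each sum has exactly one term; when they are not
   both irreducible characters there are no such vertices and the value is 0. *)
Definition McKay_arrows (f f' : {ffun gT -> C}) : nat :=
  (\sum_(i : irrs | repr_char (irr_repr i) == f)
   \sum_(j : irrs | repr_char (irr_repr j) == f') McKay_mx i j)%N.

End McKay.

Lemma pchar'_complex : ([pchar C]^').-group%g G.
Proof.
by apply/pgroupP=> p _; rewrite inE /= pchar_num.
Qed.

Lemma irr_dsum_exists n (rG : mx_representation C G n) :
  exists mult, mx_rsim rG (irr_dsum mult).
Proof.
pose sG := DecSocleType rG.
have C'G := pchar'_complex.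
pose st (W : sG) : irrs := irr_comp irrs (socle_repr W).
pose soc i := [pick W | st W == i].
exists [ffun i => oapp (fun W => socle_mult W) 0%N (soc i)].
pose W i := oapp val 0 (soc i); pose S := (\sum_i W i)%MS.
have [defS dxS]: (S :=: 1%:M)%MS /\ mxdirect S.
  rewrite /S mxdirectE /= !(bigID soc xpredT) /=.
  rewrite addsmxC big1 => [|i]; last by rewrite /W; case (soc i).
  rewrite adds0mx_id addnC (@big1 nat) ?add0n => [|i]; last first.
    by rewrite /W; case: (soc i); rewrite ?mxrank0.
  have <-: Socle sG = 1%:M := reducible_Socle1 sG (mx_Maschke_pchar rG C'G).
  have [W0 _ | noW] := pickP sG; last first.
    suff no_i: (soc : pred irrs) =1 xpred0 by rewrite /Socle !big_pred0 ?mxrank0.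
    by move=> i; rewrite /soc; case: pickP => // W0; have:= noW W0.
  have irrK Wi: soc (st Wi) = Some Wi.
    rewrite /soc; case: pickP => [W' | /(_ Wi)] /= /eqP // eqWi.
    apply/eqP/socle_rsimP.
    apply: mx_rsim_trans
      (rsim_irr_comp_pchar irrs C'G (socle_irr _)) (mx_rsim_sym _).
    by rewrite [irr_comp _ _]eqWi; apply: rsim_irr_comp_pchar (socle_irr _).
  have bij_irr: {on [pred i | soc i], bijective st}.
    exists (odflt W0 \o soc) => [Wi _ | i]; first by rewrite /= irrK.
    by rewrite inE /soc /=; case: pickP => //= Wi; move/eqP.
  rewrite !(reindex st) {bij_irr}//=.
  have all_soc Wi: soc (st Wi) by rewrite irrK.
  rewrite (eq_bigr val) => [|Wi _]; last by rewrite /W irrK.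
  rewrite !(eq_bigl _ _ all_soc); split=> //.
  rewrite (eq_bigr (mxrank \o val)) => [|Wi _]; last by rewrite /W irrK.
  by rewrite -mxdirectE /= Socle_direct.
pose modW i : mxmodule rG (W i) :=
  if soc i is Some Wi as oWi return mxmodule rG (oapp val 0 oWi) then
    component_mx_module rG (socle_base Wi)
  else mxmodule0 rG n.
apply: mx_rsim_trans (mx_rsim_sym (rsim_submod1 (mxmodule1 rG) _)) _ => //.
apply: mx_rsim_dsum (modW) _ defS dxS _ => i.
rewrite ffunE /W /modW /soc; case: pickP => [Wi|_] /=; last first.
  rewrite /muln_grepr big_ord0.
  by exists 0 => [||x _]; rewrite /row_free ?mxrank0 ?mulmx0 ?mul0mx.
move/eqP=> <-; apply: mx_rsim_socle.
exact: rsim_irr_comp_pchar (socle_irr Wi).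
Qed.

Lemma irr_multP n (rG : mx_representation C G n) :
  mx_rsim rG (irr_dsum (irr_mult rG)).
Proof. by have [m sim_m] := irr_dsum_exists rG; apply: (@xgetPex _ _ [set mult | mx_rsim rG (irr_dsum mult)]); exists m. Qed.

End Repr.

Section Outer.

Variables (R : realType) (gT hT : finGroupType).
Variables (G : {group gT}) (H : {group hT}).
Local Notation C := R[i].

Section OuterRepr.

Variables (m n : nat).
Variables (rho : mx_representation C G m) (sigma : mx_representation C H n).

Fact outer_mx_repr :
  mx_repr (setX_group G H) (fun x : gT * hT => tprod (rho x.1) (sigma x.2)).
Proof.
split=> [|[x1 x2] [y1 y2] /=]; first by rewrite !repr_mx1 tprod1.
by rewrite !inE => /andP[? ?] /andP[? ?]; rewrite !repr_mxM // tprodE.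
Qed.

Definition outer_repr : mx_representation C (setX_group G H) (m * n) :=
  MxRepresentation outer_mx_repr.

End OuterRepr.

Definition outer_char (f : {ffun gT -> C}) (f' : {ffun hT -> C}) :
    {ffun gT * hT -> C} :=
  [ffun x => f x.1 * f' x.2].

End Outer.

(* Main.v *)
(* Over an algebraically closed field the matrices of an irreducible
   representation span the full matrix algebra; as every matrix is a sum of
   Kronecker products, the outer tensor product of irreducible representations
   of G and H is again irreducible. Decomposing rho * chi_i and sigma * psi_k
   into irreducible characters, the character of
   (rho (x) sigma) (x) (chi_i x psi_k) becomes the sum of the characters
   chi_j x psi_l with coefficients a_ij b_kl. Irreducible characters are linearly
   independent, by evaluating them on the central idempotents of the group
   algebra, so these coefficients are the multiplicities. *)

Require Import Defs.
From HB Require Import structures.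
From mathcomp Require Import all_boot all_order all_algebra all_fingroup.
From mathcomp Require Import all_character reals complex.

Set Implicit Arguments.
Unset Strict Implicit.
Unset Printing Implicit Defensive.

Import GRing.Theory Num.Theory.
Local Open Scope ring_scope.

(** * Kronecker products: bilinearity and generation of all matrices *)

Lemma tprod_linearl (F : fieldType) m1 n1 m2 n2 (B : 'M[F]_(m2, n2)) :
  linear (fun A : 'M[F]_(m1, n1) => tprod A B).
Proof.
elim: m1 => [|m1 IH] a A1 A2 /=; first by rewrite scaler0 addr0.
rewrite !linearP /= IH -[trow _ B]trowbE linearP /= !trowbE.
by rewrite scale_col_mx add_col_mx.
Qed.

Lemma tprod_linearr (F : fieldType) m1 n1 m2 n2 (A : 'M[F]_(m1, n1)) :
  linear (fun B : 'M[F]_(m2, n2) => tprod A B).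
Proof.
elim: m1 A => [|m1 IH] A a B1 B2 /=; first by rewrite scaler0 addr0.
by rewrite linearP IH scale_col_mx add_col_mx.
Qed.

HB.instance Definition _ (F : fieldType) m1 n1 m2 n2 (A : 'M[F]_(m1, n1)) :=
  GRing.isSemilinear.Build _ _ _ _ (@tprod F m1 n1 A m2 n2)
    (GRing.semilinear_linear (@tprod_linearr F m1 n1 m2 n2 A)).

(* [tprod] with its arguments swapped, to carry linearity in the first one. *)
Definition tprodr (F : fieldType) m1 n1 m2 n2 (B : 'M[F]_(m2, n2))
  (A : 'M[F]_(m1, n1)) := tprod A B.

HB.instance Definition _ (F : fieldType) m1 n1 m2 n2 (B : 'M[F]_(m2, n2)) :=
  GRing.isSemilinear.Build _ _ _ _ (@tprodr F m1 n1 m2 n2 B)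
    (GRing.semilinear_linear (@tprod_linearl F m1 n1 m2 n2 B)).

(** Induction on [n1]: the leftmost block of a matrix is [trow] of the first unit row with that
    block, and the remaining columns come from a shorter row padded with 0 on the left. *)
Lemma trow_ind (F : fieldType) n1 m2 n2 (P : 'M[F]_(m2, n1 * n2) -> Prop) :
    (forall (A : 'rV_n1) (B : 'M_(m2, n2)), P (trow A B)) ->
    (forall M N, P M -> P N -> P (M + N)) ->
  forall M, P M.
Proof.
elim: n1 P => [|n1 IH] P Ptrow PD M.
  by rewrite [M]thinmx0; move: (Ptrow 0 0); rewrite trow0.
rewrite -[M](@hsubmxK _ m2 n2 (n1 * n2)) -[lsubmx _]addr0 -[rsubmx _]add0r.
rewrite -add_row_mx; apply: (PD).
  have := Ptrow (row_mx 1%:M 0 : 'rV_(1 + n1))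
                (lsubmx (M : 'M_(m2, n2 + n1 * n2))).
  by rewrite /= row_mxKl row_mxKr !mxE scale1r trow0.
apply: (IH (fun N => P (row_mx 0 N))) => [A B|N1 N2 P1 P2].
  have := Ptrow (row_mx 0 A : 'rV_(1 + n1)) B.
  by rewrite /= row_mxKl row_mxKr !mxE scale0r.
by rewrite -[0]addr0 -add_row_mx; apply: (PD).
Qed.

Lemma tprod_ind (F : fieldType) m1 n1 m2 n2
    (P : 'M[F]_(m1 * m2, n1 * n2) -> Prop) :
    (forall (A : 'M_(m1, n1)) (B : 'M_(m2, n2)), P (tprod A B)) ->
    (forall M N, P M -> P N -> P (M + N)) ->
  forall M, P M.
Proof.
elim: m1 P => [|m1 IH] P Ptprod PD M.
  by rewrite [M]flatmx0; apply: (Ptprod 0 0).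
have tprod0 (B : 'M_(m2, n2)) : tprod (0 : 'M_(m1, n1)) B = 0.
  exact: (raddf0 (tprodr B)).
(* The same splitting by block rows: [trow_ind] handles the top block, where [A] is a single row,
   and the induction hypothesis the rest. *)
rewrite -[M](@vsubmxK _ m2 (m1 * m2)) -[usubmx _]addr0 -[dsubmx _]add0r.
rewrite -add_col_mx; apply: (PD).
  apply: (@trow_ind F n1 m2 n2 (fun N => P (col_mx N 0))) => [A B|N1 N2 P1 P2].
    have := Ptprod (col_mx A 0 : 'M_(1 + m1, n1)) B.
    by rewrite /= col_mxKu col_mxKd tprod0.
  by rewrite -[0]addr0 -add_col_mx; apply: (PD).
apply: (IH (fun N => P (col_mx 0 N))) => [A B|N1 N2 P1 P2].
  have := Ptprod (col_mx 0 A : 'M_(1 + m1, n1)) B.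
  by rewrite /= col_mxKu col_mxKd trow0.
by rewrite -[0]addr0 -add_col_mx; apply: (PD).
Qed.

Lemma outer_repr_abs_irr (R : realType) (gT hT : finGroupType)
    (G : {group gT}) (H : {group hT}) m n
    (rG : mx_representation R[i] G m) (rH : mx_representation R[i] H n) :
    mx_absolutely_irreducible rG -> mx_absolutely_irreducible rH ->
  mx_absolutely_irreducible (outer_repr rG rH).
Proof.
case/mx_abs_irrP=> m_gt0 [a defA] /mx_abs_irrP[n_gt0 [b defB]].
rewrite /mx_absolutely_irreducible muln_gt0 m_gt0 n_gt0 /= -sub1mx.
set E := enveloping_algebra_mx _.
suff inE M : (M \in E)%MS by apply/row_subP=> i; rewrite -[row i _]vec_mxK inE.
move: M; apply: tprod_ind => [A B|M N ME NE]; last by rewrite linearD addmx_sub.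
(* By bilinearity, [tprod A B] is a combination of the matrices by which the pairs [(x, y)] act. *)
rewrite {1}[A]defA {1}[B]defB.
rewrite -[tprod _ _]/(tprodr _ _) !linear_sum summx_sub // => x Gx.
rewrite !linearZ /= /tprodr scalemx_sub // !linear_sum summx_sub // => y Hy.
rewrite !linearZ /= scalemx_sub //.
apply: (@envelop_mx_id _ _ _ _ (outer_repr rG rH) (x, y)).
by rewrite inE Gx.
Qed.

(** * Characters and multiplicities of irreducibles *)

Lemma repr_char_rsim (R : realType) (gT : finGroupType) (G : {group gT}) m n
    (rG : mx_representation R[i] G m) (rG' : mx_representation R[i] G n) :
  mx_rsim rG rG' -> repr_char rG = repr_char rG'.
Proof.
case/mx_rsim_def=> f [f' fK def_rG]; apply/ffunP=> x; rewrite !ffunE.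
have [Gx|//] := boolP (x \in G).
by rewrite def_rG // mxtrace_mulC mulmxA fK mul1mx.
Qed.

Lemma repr_char_irr_dsum (R : realType) (gT : finGroupType) (G : {group gT})
    (mult : {ffun irrs R G -> nat}) (x : gT) :
  repr_char (irr_dsum mult) x =
    \sum_(i : irrs R G) repr_char (irr_repr i) x *+ mult i.
Proof.
have add_char : {morph (fun rG : representation R[i] G => repr_char rG x) :
    rG rG' / dadd_grepr rG rG' >-> rG + rG'}.
  by move=> rG rG'; rewrite !ffunE /= mxtrace_block mulrnDl.
have char0 : repr_char (grepr0 : representation R[i] G) x = 0.
  by rewrite ffunE mxtrace1 mul0rn.
rewrite /irr_dsum (big_morph _ add_char char0); apply: eq_bigr => i _.
by rewrite (big_morph _ add_char char0) sumr_const card_ord.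
Qed.

Lemma repr_char_irr_mult (R : realType) (gT : finGroupType) (G : {group gT}) n
    (rG : mx_representation R[i] G n) (x : gT) :
  repr_char rG x =
    \sum_(i : irrs R G) repr_char (irr_repr i) x *+ irr_mult rG i.
Proof. by rewrite (repr_char_rsim (irr_multP rG)) repr_char_irr_dsum. Qed.

(* The j-th primitive central idempotent of the group algebra acts as the
   identity on [irr_repr j] and as 0 on the other irreducibles; its coefficients
   are the values of the functional that reads off the multiplicity of j from a
   character, up to the factor [irr_degree j]. *)
Definition irr_dual (R : realType) (gT : finGroupType) (G : {group gT})
    (j : irrs R G) (x : gT) : R[i] :=
  gring_row (Wedderburn_id j) 0 (gring_index G x) / (irr_degree j)%:R.

(** The sum is the trace of the idempotent acting in [irr_repr i], expanded over the group elements
    and divided by [irr_degree j]. *)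
Lemma irr_dualP (R : realType) (gT : finGroupType) (G : {group gT})
    (i j : irrs R G) :
  \sum_(x in G) irr_dual j x * repr_char (irr_repr i) x = (i == j)%:R.
Proof.
have C'G := pchar'_complex R G.
transitivity
  (\tr (gring_op (irr_repr i) (Wedderburn_id j)) / (irr_degree j)%:R).
  rewrite gring_opE /gring_mx /= mulmx_sum_row !linear_sum /= mulr_suml.
  rewrite (reindex _ (enum_val_bij_in (group1 G))) //=.
  apply: eq_big => [k|k _]; first exact: enum_valP.
  rewrite !linearZ /= rowK mxvecK ffunE enum_valP mulr1n /irr_dual.
  by rewrite /gring_index enum_valK_in mulrAC.
have [->|ne_ij] := eqVneq i j.
  rewrite op_Wedderburn_id_pchar // mxtrace1 divff //.
  by rewrite pnatr_eq0 -lt0n irr_degree_gt0.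
rewrite (irr_repr'_op0_pchar C'G _ (Wedderburn_id_mem j)) 1?eq_sym //.
by rewrite mxtrace0 mul0r.
Qed.

(** The family [t] is general so as to cover both all irreducibles, with [t] the identity, and the
    outer products [irr_outer]. *)
Lemma irr_dual_sum (R : realType) (gT : finGroupType) (G : {group gT})
    (I : finType) (t : I -> irrs R G) (mult : I -> nat) (u : I) :
    injective t ->
  \sum_(x in G) irr_dual (t u) x *
      (\sum_v repr_char (irr_repr (t v)) x *+ mult v) = (mult u)%:R.
Proof.
move=> inj_t.
have dualE v : \sum_(x in G) irr_dual (t u) x *
    (repr_char (irr_repr (t v)) x *+ mult v) = (v == u)%:R *+ mult v.
  rewrite -(inj_eq inj_t) -irr_dualP -sumrMnl.
  by apply: eq_bigr => x _; rewrite mulrnAr.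
under eq_bigr do rewrite mulr_sumr.
rewrite exchange_big /= (eq_bigr _ (fun v _ => dualE v)) (bigD1 u) //= eqxx.
by rewrite big1 ?addr0 // => v /negPf->; rewrite mul0rn.
Qed.

Lemma irr_mult_unique (R : realType) (gT : finGroupType) (G : {group gT}) n
    (rG : mx_representation R[i] G n)
    (I : finType) (t : I -> irrs R G) (mult : I -> nat) :
    injective t ->
    (forall x,
       repr_char rG x = \sum_v repr_char (irr_repr (t v)) x *+ mult v) ->
  forall u, irr_mult rG (t u) = mult u.
Proof.
move=> inj_t charE u; apply/eqP; rewrite -(eqr_nat R[i]).
(* The functional [irr_dual (t u)] is applied to two expansions of one character: over all
   irreducibles, and over [t]. *)
rewrite -(irr_dual_sum _ (t u) (@inj_id (irrs R G))) -(irr_dual_sum _ u inj_t).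
by apply/eqP/eq_bigr => x _; rewrite -repr_char_irr_mult charE.
Qed.

Lemma irr_char_inj (R : realType) (gT : finGroupType) (G : {group gT}) :
  injective (fun i : irrs R G => repr_char (irr_repr i)).
Proof.
move=> i j eq_ij; apply/eqP; rewrite -[_ == _]eqb1 -(eqr_nat R[i]) -irr_dualP.
by rewrite eq_ij irr_dualP eqxx.
Qed.

Lemma is_irr_charP (R : realType) (gT : finGroupType) (G : {group gT})
    (f : {ffun gT -> R[i]}) :
  is_irr_char G f -> exists i : irrs R G, f = repr_char (irr_repr i).
Proof.
case=> n [rG [irrG <-]]; exists (irr_comp (irrs R G) rG).
exact/repr_char_rsim/rsim_irr_comp_pchar/irrG/pchar'_complex.
Qed.

Lemma McKay_arrows_irr (R : realType) (gT : finGroupType) (G : {group gT}) n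
    (rho : mx_representation R[i] G n) (i j : irrs R G) :
  McKay_arrows rho (repr_char (irr_repr i)) (repr_char (irr_repr j)) =
    McKay_mx rho i j.
Proof.
have charE (u v : irrs R G) :
    (repr_char (irr_repr u) == repr_char (irr_repr v)) = (u == v).
  by apply/eqP/eqP=> [/irr_char_inj|->].
by rewrite /McKay_arrows; under eq_bigl do rewrite charE;
  rewrite big_pred1_eq; under eq_bigl do rewrite charE; rewrite big_pred1_eq.
Qed.

(** * Characters of tensor products and of the product group *)

Lemma repr_char_prod (R : realType) (gT : finGroupType) (G : {group gT}) m n
    (rG : mx_representation R[i] G m) (rG' : mx_representation R[i] G n) x :
  repr_char (prod_repr rG rG') x = repr_char rG x * repr_char rG' x.
Proof.
rewrite !ffunE /= mxtrace_prod.
by case: (x \in G); rewrite ?mulr1n // !mulr0n mul0r.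
Qed.

Lemma repr_char_outer (R : realType) (gT hT : finGroupType)
    (G : {group gT}) (H : {group hT}) m n
    (rG : mx_representation R[i] G m) (rH : mx_representation R[i] H n) :
  repr_char (outer_repr rG rH) = outer_char (repr_char rG) (repr_char rH).
Proof.
apply/ffunP=> x; rewrite !ffunE /= mxtrace_prod inE.
by rewrite mulrnAl mulrnAr -mulrnA mulnb andbC.
Qed.

Definition irr_outer (R : realType) (gT hT : finGroupType)
    (G : {group gT}) (H : {group hT}) (ik : irrs R G * irrs R H) :
    irrs R (setX_group G H) :=
  irr_comp _ (outer_repr (irr_repr ik.1) (irr_repr ik.2)).

Lemma irr_outer_char (R : realType) (gT hT : finGroupType)
    (G : {group gT}) (H : {group hT}) (ik : irrs R G * irrs R H) :
  repr_char (irr_repr (irr_outer ik)) =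
    outer_char (repr_char (irr_repr ik.1)) (repr_char (irr_repr ik.2)).
Proof.
rewrite -repr_char_outer; apply/esym/repr_char_rsim/rsim_irr_comp_pchar.
  exact: pchar'_complex.
(* [R[i]] is algebraically closed, so the irreducible factors are absolutely irreducible. *)
apply/mx_abs_irrW/outer_repr_abs_irr;
  by apply: group_closure_closed_field; apply: socle_irr.
Qed.

Lemma sum_setX_mul (K : comPzRingType) (gT hT : finGroupType)
    (G : {group gT}) (H : {group hT}) (f : gT -> K) (g : hT -> K) :
  \sum_(z in setX_group G H) f z.1 * g z.2 =
    (\sum_(x in G) f x) * (\sum_(y in H) g y).
Proof.
rewrite big_distrlr /= pair_big /=.
by apply: eq_bigl => z; rewrite inE.
Qed.

Lemma irr_outer_inj (R : realType) (gT hT : finGroupType)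
    (G : {group gT}) (H : {group hT}) :
  injective (@irr_outer R gT hT G H).
Proof.
move=> [i k] [j l] /(congr1 (fun T => repr_char (irr_repr T))).
rewrite !irr_outer_char /= => /ffunP eq_char.
(* The product of the functionals dual to [j] and [l] is 1 on the outer character of [(j, l)] and 0
   on the others, hence separates them. *)
have dualE u v : \sum_(z in setX_group G H)
    irr_dual j z.1 * irr_dual l z.2 *
    outer_char (repr_char (irr_repr u)) (repr_char (irr_repr v)) z =
    ((u, v) == (j, l))%:R.
  rewrite xpair_eqE -mulnb natrM -!irr_dualP -sum_setX_mul.
  by apply: eq_bigr => z _; rewrite ffunE mulrACA.
apply/eqP; rewrite -[_ == _]eqb1 -(eqr_nat R[i]) -dualE.
by under eq_bigr do rewrite eq_char; rewrite dualE eqxx.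
Qed.

Lemma McKay_mx_outer (R : realType) (gT hT : finGroupType)
    (G : {group gT}) (H : {group hT}) m n
    (rho : mx_representation R[i] G m) (sigma : mx_representation R[i] H n)
    (ik jl : irrs R G * irrs R H) :
  McKay_mx (outer_repr rho sigma) (irr_outer ik) (irr_outer jl) =
    (McKay_mx rho ik.1 jl.1 * McKay_mx sigma ik.2 jl.2)%N.
Proof.
pose mult jl := (McKay_mx rho ik.1 jl.1 * McKay_mx sigma ik.2 jl.2)%N.
apply: (irr_mult_unique (mult := mult)) => [|z]; first exact: irr_outer_inj.
rewrite repr_char_prod repr_char_outer irr_outer_char.
(* The four factors are regrouped into the characters of [rho] tensored with [irr_repr ik.1] and of
   [sigma] tensored with [irr_repr ik.2]; both are then expanded and multiplied out. *)
rewrite [outer_char _ _ z]ffunE [X in _ * X]ffunE mulrACA.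
rewrite -!repr_char_prod !repr_char_irr_mult big_distrlr pair_big /=.
apply: eq_bigr => -[j l] _; rewrite irr_outer_char [outer_char _ _ z]ffunE /=.
by rewrite mulrnAl mulrnAr -mulrnA [in LHS]mulnC.
Qed.

Theorem theorem2p3 (R : realType) (gT hT : finGroupType)
    (G : {group gT}) (H : {group hT}) (r s : nat)
    (chi : 'I_r.+1 -> {ffun gT -> R[i]}) (psi : 'I_s.+1 -> {ffun hT -> R[i]})
    (hchi : irr_char_enum G chi) (hpsi : irr_char_enum H psi)
    (m n : nat) (rho : mx_representation R[i] G m)
    (sigma : mx_representation R[i] H n)
    (i j : 'I_r.+1) (k l : 'I_s.+1) :
  McKay_arrows (outer_repr rho sigma)
    (outer_char (chi i) (psi k)) (outer_char (chi j) (psi l)) =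
  (McKay_arrows rho (chi i) (chi j) * McKay_arrows sigma (psi k) (psi l))%N.
Proof.
have chiP i0 : exists i1 : irrs R G, chi i0 = repr_char (irr_repr i1).
  by apply/is_irr_charP/hchi.2; exists i0.
have psiP k0 : exists k1 : irrs R H, psi k0 = repr_char (irr_repr k1).
  by apply/is_irr_charP/hpsi.2; exists k0.
have [[i1 ->] [j1 ->]] := (chiP i, chiP j).
have [[k1 ->] [l1 ->]] := (psiP k, psiP l).
(* The vertices of the product quiver become characters of [irr_outer], so each arrow count is a
   single value of [McKay_mx]. *)
rewrite -(irr_outer_char (i1, k1)) -(irr_outer_char (j1, l1)).
by rewrite !McKay_arrows_irr McKay_mx_outer.
Qed.
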